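(* The following two statements are equivalent: (i) $\mathrm{ddell}\,\Lambda<\infty$ for every Artin algebra $\Lambda$ (the derived delooping level conjecture); (ii) for every Artin algebra $\Lambda$, if $\mathrm{ddell}\,\Lambda=0$ then $\mathrm{ddell}\,\Lambda^{\mathrm{op}}<\infty$.
   Context: Let $\Lambda$ be an Artin algebra. Modules are right modules; $\mathrm{mod}\,\Lambda$ is the category of finitely generated right $\Lambda$-modules, and $\mathrm{mod}\,\Lambda^{\mathrm{op}}$ that of finitely generated left $\Lambda$-modules. $\mathbb{N}=\mathbb{Z}_{\ge 0}$ and $\inf\emptyset=+\infty$. For $M\in\mathrm{mod}\,\Lambda$, the syzygy $\Omega M$ is the kernel of the projective cover $P(M)\to M$, and $\Omega^0M=M$, $\Omega^{n+1}M=\Omega(\Omega^nM)$. $M$ is a stable retract of $N$ if $M$ is a direct summand of $N\oplus P$ for some projective module $P\in\mathrm{mod}\,\Lambda$. For a positive integer $k$, the $k$-delooping level of $M\in\mathrm{mod}\,\Lambda$ is $$k\text{-}\mathrm{dell}\,M=\inf\{n\in\mathbb{N}\mid \Omega^nM\text{ is a stable retract of }\Omega^{n+k}N\text{ for some }N\in\mathrm{mod}\,\Lambda\}.$$ The derived delooping level $\mathrm{ddell}\,M$ of $M\in\mathrm{mod}\,\Lambda$ is the infimum of the $m\in\mathbb{N}$ for which there exist $n\in\mathbb{N}$ with $n\le m$ and an exact sequence in $\mathrm{mod}\,\Lambda$ $$0\to C_n\to C_{n-1}\to\cdots\to C_1\to C_0\to M\to 0$$ with $(i+1)\text{-}\mathrm{dell}\,C_i\le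 m-i$ for $i=0,1,\dots,n$. The derived delooping level of the algebra is $\mathrm{ddell}\,\Lambda=\sup\{\mathrm{ddell}\,S\mid S\text{ a simple right }\Lambda\text{-module}\}$. *)

(* Defs.v *)
From HB Require Import structures.
From mathcomp Require Import all_boot all_order all_algebra.
From mathcomp Require Import mathcomp_extra boolp classical_sets constructive_ereal.

Set Implicit Arguments.
Unset Strict Implicit.
Unset Printing Implicit Defensive.

Import Order.TTheory GRing.Theory Num.Theory.
Local Open Scope ring_scope.
Local Open Scope classical_set_scope.

(* Everything up to [ddell] is stated for left modules over a ring [A] (the
   [lmodType A] of the library). Right modules over [A] are left modules over
   the converse ring [A^c]; this is used in [ddell_alg]. The rings are
   [pzRingType]s, so that the zero algebra is not excluded. *)

Section Modules.
Variable A : pzRingType.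

Definition submodule (M : lmodType A) (N : set M) : Prop :=
  N 0 /\ forall (a : A) (x y : M), N x -> N y -> N (a *: x + y).

Definition simple_module (M : lmodType A) : Prop :=
  (exists x : M, x != 0) /\
  forall N : set M, submodule N -> N = [set 0] \/ N = [set: M].

Definition artinian_module (M : lmodType A) : Prop :=
  forall N : nat -> set M,
    (forall n, submodule (N n)) -> (forall n, N n.+1 `<=` N n) ->
    exists n0 : nat, forall n : nat, (n0 <= n)%N -> N n = N n0.

Definition finitely_generated (M : lmodType A) : Prop :=
  exists (n : nat) (v : 'I_n -> M),
    forall x : M, exists c : 'I_n -> A, x = \sum_(i < n) c i *: v i.

Definition isomorphic (M N : lmodType A) : Prop :=
  exists f : {linear M -> N}, bijective f.

Definition ker (M N : lmodType A) (f : {linear M -> N}) : set M :=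
  f @^-1` [set 0].

Definition projective (P : lmodType A) : Prop :=
  forall (M N : lmodType A) (g : {linear M -> N}) (f : {linear P -> N}),
    range g = [set: N] ->
    exists h : {linear P -> M}, forall x : P, g (h x) = f x.

Definition superfluous (M : lmodType A) (K : set M) : Prop :=
  forall N : set M, submodule N ->
    [set x + y | x in N & y in K] = [set: M] -> N = [set: M].

Definition projective_cover (P M : lmodType A) (p : {linear P -> M}) : Prop :=
  [/\ finitely_generated P, projective P, range p = [set: M]
    & superfluous (ker p)].

(* Projective covers, hence syzygies, are only defined up to isomorphism:
   [is_syzygy M K] says that K is (isomorphic to) Omega M, and
   [is_nth_syzygy n M K] that K is (isomorphic to) Omega^n M. *)
Definition is_syzygy (M K : lmodType A) : Prop :=
  exists (P : lmodType A) (p : {linear P -> M}) (i : {linear K -> P}),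
    [/\ projective_cover p, injective i & range i = ker p].

Fixpoint is_nth_syzygy (n : nat) (M K : lmodType A) : Prop :=
  if n is n'.+1 then
    exists L : lmodType A, is_nth_syzygy n' M L /\ is_syzygy L K
  else isomorphic M K.

Definition direct_summand (M N : lmodType A) : Prop :=
  exists M' : lmodType A, isomorphic (M * M')%type N.

Definition stable_retract (M N : lmodType A) : Prop :=
  exists P : lmodType A,
    [/\ finitely_generated P, projective P & direct_summand M (N * P)%type].

(* Infimum in [\bar int] of a set of natural numbers, with inf set0 = +oo. *)
Definition nat_inf (S : set nat) : \bar int :=
  infimum +oo%E [set (n%:Z)%:E | n in S].

Definition dell (k : nat) (M : lmodType A) : \bar int :=
  nat_inf [set n | exists K N L : lmodType A,
    [/\ is_nth_syzygy n M K, finitely_generated N,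
        is_nth_syzygy (n + k)%N N L & stable_retract K L]].

(* 0 -> C n -> ... -> C 1 -> C 0 -> M -> 0 is encoded as an exact sequence
   indexed by all of nat whose terms vanish beyond n;
   [d i : C i.+1 -> C i] and [e : C 0 -> M] are its maps. *)
Definition exact_resolution (n : nat) (M : lmodType A) (C : nat -> lmodType A)
    (d : forall i : nat, {linear C i.+1 -> C i}) (e : {linear C 0%N -> M}) :
    Prop :=
  [/\ forall i : nat, finitely_generated (C i),
      forall i : nat, (n < i)%N -> [set: C i] = [set 0],
      range e = [set: M],
      range (d 0%N) = ker e
    & forall i : nat, range (d i.+1) = ker (d i)].

Definition ddell (M : lmodType A) : \bar int :=
  nat_inf [set m | exists2 n : nat, (n <= m)%N &
    exists (C : nat -> lmodType A) (d : forall i, {linear C i.+1 -> C i})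
           (e : {linear C 0%N -> M}),
      exact_resolution n d e /\
      forall i : nat, (i <= n)%N ->
        (dell i.+1 (C i) <= ((m - i)%N%:Z)%:E)%E].

End Modules.

(* The supremum is taken in [0, +oo]: it is 0 if there is no simple module,
   that is, for the zero algebra. *)
Definition ddell_alg (A : pzRingType) : \bar int :=
  supremum 0%E
    [set x | exists S : lmodType A^c, simple_module S /\ ddell S = x].

Definition artinian_ring (R : comPzRingType) : Prop :=
  artinian_module (R^o : lmodType R).

(* [f] makes A an algebra over the commutative ring R ([algType R] is not used
   as it excludes the zero algebra). *)
Definition artin_algebra (A : pzRingType) : Prop :=
  exists (R : comPzRingType) (f : {rmorphism R -> A}),
    [/\ artinian_ring R,
        forall (r : R) (a : A), f r * a = a * f r
      & exists (n : nat) (v : 'I_n -> A),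
          forall a : A, exists c : 'I_n -> R,
            a = \sum_(i < n) f (c i) * v i].

(* Main.v *)
Require Import Defs.
From HB Require Import structures.
From mathcomp Require Import all_boot all_order all_algebra.
From mathcomp Require Import boolp classical_sets constructive_ereal.

Set Implicit Arguments.
Unset Strict Implicit.
Unset Printing Implicit Defensive.

Import Order.TTheory GRing.Theory Num.Theory.
Local Open Scope ring_scope.
Local Open Scope classical_set_scope.
Local Open Scope quotient_scope.

(** The content is that (ii) implies (i); the converse holds because the
    converse ring of an Artin algebra is again an Artin algebra.

    Given an Artin algebra [A] over [R], one builds an Artin algebra [H] such
    that [H^c] has derived delooping level 0 while [A] is a corner of [H] that
    is seen well by the modules on the other side. Let [D = A * R], let [V] be
    the left [D]-module [D / J], where [J] is the annihilator of all simple
    modules, and let [H] be the trivial extension of [D] by [V], where [D]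
    acts on [V] from the right only through its second factor [R].

    On left modules. Since [D] is left artinian, [V] contains a copy of each
    simple left [D]-module ([simple_embeds]). As [V] is an ideal of square
    zero in [H], it kills the simple left [H]-modules, so that these are the
    simple [D]-modules, and each of them, say [T], embeds into [V], hence into
    [H]. Moreover every left ideal inside [V] is superfluous in [H]; therefore
    [H -> H / T] is a projective cover and [T] is a syzygy. Hence [ddell T = 0]
    ([ddell_simple_eq0], [ddell_alg_kasch]).

    On right modules. Let [e] be the idempotent [(1, 0)] of [D], viewed in [H].
    The right action of [e] on [V] is zero, so [H e = e H e], and this ring is
    [A]; in particular [h |-> h e] is a ring morphism from [H] onto [A]. The
    functor [M |-> M e] from right [H]-modules to right [A]-modules is exact
    and its right adjoint is restriction of scalars along [H -> A], which is
    exact too; hence it preserves projective modules. It also preserves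
    superfluous kernels, so it preserves projective covers and thus all
    syzygies ([corner_nth_syzygy]). It sends a simple [A]-module, restricted to
    [H], back to itself, so a resolution that computes [ddell] over [H] is
    mapped to one over [A] with no larger delooping levels. This gives
    [ddell_alg A <= ddell_alg H^c^c] ([ddell_alg_corner]), and (ii) applied to
    [H^c] bounds the right-hand side. *)

(** * Infima and suprema of natural numbers *)

Section Infimum.
Implicit Types S : set nat.

Lemma nat_infP S :
  (S = set0 /\ nat_inf S = +oo%E) \/
  exists n, [/\ S n, forall m, S m -> (n <= m)%N & nat_inf S = n%:Z%:E].
Proof.
have [->|/set0P [k Sk]] := eqVneq S set0.
  by left; split=> //; rewrite /nat_inf image_set0 /infimum eqxx.
right; have exS : exists n, `[< S n >] by exists k; apply/asboolP.
case: (ex_minnP exS) => n /asboolP Sn nS; exists n; split=> // [m Sm|].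
  exact/nS/asboolP.
have infn : infimums [set (m%:Z)%:E | m in S] n%:Z%:E.
  split=> [_ [m Sm <-]|y]; first by rewrite lee_fin lez_nat; exact/nS/asboolP.
  by apply; exists n.
rewrite /nat_inf /infimum; case: ifPn => [/eqP E|_].
  have : [set (m%:Z)%:E | m in S] n%:Z%:E by exists n.
  by rewrite E.
case: xgetP => [y _ infy|/(_ _ infn) //].
exact: is_subset1_infimums infy infn.
Qed.

Definition nat_or_pinfty (x : \bar int) := x = +oo%E \/ exists n : nat, x = n%:Z%:E.

Lemma nat_inf_nat_or_pinfty S : nat_or_pinfty (nat_inf S).
Proof. by case: (nat_infP S) => [[_ ->]|[n [_ _ ->]]]; [left|right; exists n]. Qed.

Lemma nat_inf_ge0 S : (0 <= nat_inf S)%E.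
Proof. by case: (nat_inf_nat_or_pinfty S) => [->|[n ->]]. Qed.

Lemma nat_inf_le S n : S n -> (nat_inf S <= n%:Z%:E)%E.
Proof.
case: (nat_infP S) => [[-> //]|[m [_ mS ->]] /mS mn].
by rewrite lee_fin lez_nat.
Qed.

Lemma subset_nat_inf S S' : S `<=` S' -> (nat_inf S' <= nat_inf S)%E.
Proof.
move=> SS'; case: (nat_infP S) => [[_ ->]|[n [Sn _ ->]]]; first exact: leey.
exact/nat_inf_le/SS'.
Qed.

Lemma nat_or_pinfty_supremums (X : set (\bar int)) :
  X !=set0 -> X `<=` nat_or_pinfty -> supremums X !=set0.
Proof.
move=> [x Xx] Xnat.
have [[b bX]|nb] := pselect (exists b : nat, ubound X b%:Z%:E).
  have exX : exists n : nat, `[< X n%:Z%:E >].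
    case: (Xnat _ Xx) => [xE|[n xE]]; last by exists n; apply/asboolP; rewrite -xE.
    by have := bX _ Xx; rewrite xE.
  have leb n : `[< X n%:Z%:E >] -> (n <= b)%N.
    by move=> /asboolP /bX; rewrite lee_fin lez_nat.
  case: (ex_maxnP exX leb) => n /asboolP Xn maxn; exists n%:Z%:E; split; last first.
    by move=> y; apply.
  move=> y Xy; case: (Xnat _ Xy) => [yE|[m yE]].
    by have := bX _ Xy; rewrite yE.
  by rewrite yE lee_fin lez_nat; apply/maxn/asboolP; rewrite -yE.
exists +oo%E; split=> [y _|[r|//|]]; first exact: leey.
  move=> rX; case: nb; exists `|r|%N => y /rX /le_trans; apply.
  by rewrite lee_fin; case: r {rX} => // r; rewrite NegzE; exact: le_trans (lerN10 _) _.
by move=> /(_ _ Xx); case: (Xnat _ Xx) => [->|[n ->]].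
Qed.

Lemma supremum_le (X Y : set (\bar int)) :
  X `<=` nat_or_pinfty -> Y `<=` nat_or_pinfty ->
  (forall x, X x -> exists2 y, Y y & (x <= y)%E) ->
  (supremum 0%E X <= supremum 0%E Y)%E.
Proof.
move=> Xnat Ynat XY.
have Yge0 : (0 <= supremum 0%E Y)%E.
  have [->|/set0P Y0] := eqVneq Y set0; first by rewrite supremum0.
  have [y Yy] := Y0; have supY := nat_or_pinfty_supremums Y0 Ynat.
  apply: le_trans (ge_supremum_Nmem _ supY Yy).
  by case: (Ynat _ Yy) => [->|[n ->]].
have [->|/set0P X0] := eqVneq X set0; first by rewrite supremum0.
rewrite {1}/supremum; case: ifP => // _; case: xgetP => // z _ [_]; apply.
move=> x /XY [y Yy xy]; apply: le_trans xy _; have Y0 : Y !=set0 by exists y.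
exact: ge_supremum_Nmem (nat_or_pinfty_supremums Y0 Ynat) Yy.
Qed.

End Infimum.

(** * Quotients, restriction of scalars and trivial extensions *)

Section LinearFun.
Variables (A : pzRingType) (M N : lmodType A) (f : M -> N).
Definition linear_fun (fL : linear f) : M -> N := f.
HB.instance Definition _ (fL : linear f) :=
  GRing.isLinear.Build A M N *:%R (linear_fun fL) fL.
End LinearFun.

Section QuotientModule.
Variables (A : pzRingType) (M : lmodType A) (N : set M).

(** The proof of [submodule N] is an argument so that the closedness instance
    below can be found from the predicate. *)
Definition submod_pred (sN : submodule N) : pred M := fun x => `[< N x >].

Variable sN : submodule N.

Lemma submod_pred_closed : zmod_closed (submod_pred sN).
Proof.
case: (sN) => N0 NL; split; first exact/asboolP.
move=> x y /asboolP Nx /asboolP Ny; apply/asboolP.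
by rewrite -scaleN1r addrC; apply: NL.
Qed.

HB.instance Definition _ := GRing.isZmodClosed.Build M (submod_pred sN) submod_pred_closed.

Definition submod_zmod : zmodClosed M := GRing.ZmodClosed.clone M (submod_pred sN) _.
Definition quotmod : Type := Quotient.quot submod_zmod.
HB.instance Definition _ := GRing.Zmodule.on quotmod.

Definition quot_pi (x : M) : quotmod := \pi_(Quotient.quot submod_zmod) x.

Lemma quot_piD : {morph quot_pi : x y / x + y}.
Proof. by move=> x y; rewrite /quot_pi -pi_addr. Qed.

Lemma quot_pi_eq x y : quot_pi x = quot_pi y <-> N (x - y).
Proof.
split=> [/eqP|Nxy]; first by rewrite /quot_pi -Quotient.idealrBE => /asboolP.
by apply/eqP; rewrite -Quotient.idealrBE; apply/asboolP.
Qed.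

Lemma quot_pi_surj (y : quotmod) : exists x, quot_pi x = y.
Proof. by exists (repr (y : Quotient.quot _)); rewrite /quot_pi reprK. Qed.

Definition quot_scale (a : A) (y : quotmod) : quotmod :=
  quot_pi (a *: sval (cid (quot_pi_surj y))).

Lemma quot_scaleE a x : quot_scale a (quot_pi x) = quot_pi (a *: x).
Proof.
rewrite /quot_scale; case: cid => /= y /quot_pi_eq Nyx; apply/quot_pi_eq.
by rewrite -scalerBr -[_ *: _]addr0; apply: sN.2 => //; case: sN.
Qed.

Lemma quot_scaleA a b v : quot_scale a (quot_scale b v) = quot_scale (a * b) v.
Proof. by have [x <-] := quot_pi_surj v; rewrite !quot_scaleE scalerA. Qed.
Lemma quot_scale1 : left_id 1 quot_scale.
Proof. by move=> v; have [x <-] := quot_pi_surj v; rewrite !quot_scaleE scale1r. Qed.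
Lemma quot_scaleDr : right_distributive quot_scale +%R.
Proof.
move=> a u v; have [x <-] := quot_pi_surj u; have [y <-] := quot_pi_surj v.
by rewrite -quot_piD !quot_scaleE scalerDr quot_piD.
Qed.
Lemma quot_scaleDl v : {morph quot_scale^~ v : a b / a + b}.
Proof.
by move=> a b; have [x <-] := quot_pi_surj v; rewrite !quot_scaleE scalerDl quot_piD.
Qed.

HB.instance Definition _ := GRing.Zmodule_isLmodule.Build A quotmod
  quot_scaleA quot_scale1 quot_scaleDr quot_scaleDl.

Lemma quot_pi_linear : linear quot_pi.
Proof. by move=> a x y; rewrite quot_piD -quot_scaleE. Qed.
HB.instance Definition _ := GRing.isLinear.Build A M quotmod *:%R quot_pi
  quot_pi_linear.

End QuotientModule.
Arguments quot_pi {A M N} sN.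

Section Pullback.
Variables (A B : pzRingType) (p : {rmorphism B -> A}) (M : lmodType A).

(** The morphism [p] is kept in the body because it determines the action. *)
Definition pullback : Type := let _ := p in M.
HB.instance Definition _ := GRing.Zmodule.on pullback.

Definition pullback_scale (b : B) (x : pullback) : pullback := p b *: (x : M).
Lemma pullback_scaleA a b v :
  pullback_scale a (pullback_scale b v) = pullback_scale (a * b) v.
Proof. by rewrite /pullback_scale scalerA rmorphM. Qed.
Lemma pullback_scale1 : left_id 1 pullback_scale.
Proof. by move=> v; rewrite /pullback_scale rmorph1 scale1r. Qed.
Lemma pullback_scaleDr : right_distributive pullback_scale +%R.
Proof. by move=> a u v; rewrite /pullback_scale scalerDr. Qed.
Lemma pullback_scaleDl v : {morph pullback_scale^~ v : a b / a + b}.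
Proof. by move=> a b; rewrite /pullback_scale rmorphD scalerDl. Qed.
HB.instance Definition _ := GRing.Zmodule_isLmodule.Build B pullback
  pullback_scaleA pullback_scale1 pullback_scaleDr pullback_scaleDl.
End Pullback.

Section TrivialExtension.
Variables (D R : pzRingType) (V : lmodType D).
Variables (q : {rmorphism D -> R}) (z : {rmorphism R -> D}).

Hypothesis zC : forall r d, z r * d = d * z r.

(** The right action of [D] on [V] is the left action of the central elements
    [z (q d)]; it commutes with the left action because they are central. The
    maps [q] and [z] are arguments because the product depends on them. *)
Definition trivext & {rmorphism D -> R} & (forall r d, z r * d = d * z r) : Type :=
  (D * V)%type.
Local Notation H := (trivext q zC).
HB.instance Definition _ := GRing.Zmodule.on H.

Definition trivext_one : H := (1, 0).
Definition trivext_mul (x y : H) : H :=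
  (x.1 * y.1, x.1 *: y.2 + z (q y.1) *: x.2).
Lemma trivext_mulA : associative trivext_mul.
Proof.
move=> x y w; rewrite /trivext_mul /= mulrA; congr (_, _).
by rewrite !rmorphM !scalerDr !scalerA (zC _ x.1) (zC (q w.1) (z _)) addrA.
Qed.
Lemma trivext_mul1x : left_id trivext_one trivext_mul.
Proof. by move=> [d v]; rewrite /trivext_mul /= mul1r scale1r scaler0 addr0. Qed.
Lemma trivext_mulx1 : right_id trivext_one trivext_mul.
Proof. by move=> [d v]; rewrite /trivext_mul /= mulr1 !rmorph1 scale1r scaler0 add0r. Qed.
Lemma trivext_mulDl : left_distributive trivext_mul +%R.
Proof.
move=> x y w; rewrite /trivext_mul /= mulrDl scalerDl scalerDr; congr (_, _).
by rewrite addrACA.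
Qed.
Lemma trivext_mulDr : right_distributive trivext_mul +%R.
Proof.
move=> x y w; rewrite /trivext_mul /= mulrDr !rmorphD scalerDl scalerDr.
by congr (_, _); rewrite addrACA.
Qed.
HB.instance Definition _ := GRing.Zmodule_isPzRing.Build H
  trivext_mulA trivext_mul1x trivext_mulx1 trivext_mulDl trivext_mulDr.
End TrivialExtension.
Arguments trivext {D R} V {z} _ _.

(** * The corner functor *)

(** An idempotent [e = iota 1] of [B] with [e B = e B e], together with an
    identification of the ring [e B e] with [A]. Left multiplication by [e]
    then is the ring morphism [pi] from [B] to [A]. That [iota] is additive and
    multiplicative follows from the two axioms. *)
Record corner_data (A B : pzRingType) := CornerData {
  corner_pi : {rmorphism B -> A};
  corner_iota : A -> B;
  corner_iotaK : cancel corner_iota corner_pi;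
  corner_idemE : forall b, corner_iota 1 * b = corner_iota (corner_pi b)
}.

Section Corner.
Variables (A B : pzRingType) (c : corner_data A B).
Local Notation pi := (corner_pi c).
Local Notation iota := (corner_iota c).
Local Notation e := (corner_iota c 1).

Lemma corner_idemK a : e * iota a = iota a.
Proof. by rewrite corner_idemE corner_iotaK. Qed.

Lemma corner_iotaM : {morph iota : a b / a * b}.
Proof.
move=> a b; rewrite -[in RHS](corner_idemK a) -mulrA corner_idemE.
by rewrite rmorphM /= !corner_iotaK.
Qed.

Lemma corner_iotaD : {morph iota : a b / a + b}.
Proof.
move=> a b; rewrite -(corner_idemK a) -(corner_idemK b) -mulrDr corner_idemE.
by rewrite rmorphD /= !corner_iotaK.
Qed.

Section Module.
Variable M : lmodType B.

Definition corner_pred : {pred M} := fun x => e *: x == x.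

Lemma corner_pred_closed : zmod_closed corner_pred.
Proof.
split; first by rewrite unfold_in scaler0.
by move=> x y /eqP ex /eqP ey; rewrite unfold_in scalerBr ex ey.
Qed.
HB.instance Definition _ := GRing.isZmodClosed.Build M corner_pred corner_pred_closed.

(** The [A]-module [e M]. *)
Definition corner : Type := {x : M | corner_pred x}.
HB.instance Definition _ := SubChoice.on corner.
HB.instance Definition _ := [SubChoice_isSubZmodule of corner by <:].

Definition corner_val (x : corner) : M := val x.

Lemma corner_val_inj : injective corner_val.
Proof. exact: val_inj. Qed.

Lemma corner_valE (x : corner) : e *: corner_val x = corner_val x.
Proof. exact/eqP/(valP x). Qed.

Lemma corner_proj_subproof (x : M) : corner_pred (e *: x).
Proof. by rewrite /corner_pred scalerA corner_idemK. Qed.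

Definition corner_proj (x : M) : corner := Sub (e *: x) (corner_proj_subproof x).

Lemma corner_projE (x : M) : corner_val (corner_proj x) = e *: x.
Proof. by []. Qed.

Lemma corner_valK : cancel corner_val corner_proj.
Proof. by move=> x; apply: corner_val_inj; rewrite corner_projE corner_valE. Qed.

Lemma corner_valD : {morph corner_val : x y / x + y}.
Proof. by []. Qed.

Definition corner_scale (a : A) (x : corner) : corner :=
  corner_proj (iota a *: corner_val x).

Lemma corner_val_scale a x : corner_val (corner_scale a x) = iota a *: corner_val x.
Proof. by rewrite corner_projE scalerA corner_idemK. Qed.

Lemma corner_scaleA a b v : corner_scale a (corner_scale b v) = corner_scale (a * b) v.
Proof. by apply: corner_val_inj; rewrite !corner_val_scale scalerA corner_iotaM. Qed.
Lemma corner_scale1 : left_id 1 corner_scale.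
Proof. by move=> v; apply: corner_val_inj; rewrite corner_val_scale corner_valE. Qed.
Lemma corner_scaleDr : right_distributive corner_scale +%R.
Proof.
move=> a u v; apply: corner_val_inj.
by rewrite corner_valD !corner_val_scale corner_valD scalerDr.
Qed.
Lemma corner_scaleDl v : {morph corner_scale^~ v : a b / a + b}.
Proof.
move=> a b; apply: corner_val_inj.
by rewrite corner_valD !corner_val_scale corner_iotaD scalerDl.
Qed.
HB.instance Definition _ := GRing.Zmodule_isLmodule.Build A corner
  corner_scaleA corner_scale1 corner_scaleDr corner_scaleDl.

Lemma corner_val_linear a (x y : corner) :
  corner_val (a *: x + y) = iota a *: corner_val x + corner_val y.
Proof. by rewrite corner_valD -corner_val_scale. Qed.

Lemma corner_proj_linear b (x y : M) :
  corner_proj (b *: x + y) = pi b *: corner_proj x + corner_proj y.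
Proof.
apply: corner_val_inj; rewrite corner_val_linear !corner_projE scalerDr !scalerA.
by rewrite -corner_iotaM mulr1 corner_idemE.
Qed.
End Module.

End Corner.

Section CornerFunctor.
Variables (A B : pzRingType) (c : corner_data A B).
Implicit Types M N P K L : lmodType B.

Definition corner_map M N (f : {linear M -> N}) (x : corner c M) : corner c N :=
  corner_proj c (f (corner_val x)).

Lemma corner_map_val M N (f : {linear M -> N}) x :
  corner_val (corner_map f x) = f (corner_val x).
Proof. by rewrite corner_projE -linearZ /= corner_valE. Qed.

Lemma corner_map_is_linear M N (f : {linear M -> N}) : linear (corner_map f).
Proof.
move=> a x y; apply: corner_val_inj.
by rewrite corner_val_linear !corner_map_val corner_val_linear linearP.
Qed.
HB.instance Definition _ M N (f : {linear M -> N}) :=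
  GRing.isLinear.Build A (corner c M) (corner c N) *:%R (corner_map f)
    (corner_map_is_linear f).

Lemma corner_map_proj M N (f : {linear M -> N}) x :
  corner_map f (corner_proj c x) = corner_proj c (f x).
Proof. by apply: corner_val_inj; rewrite corner_map_val !corner_projE linearZ. Qed.

Lemma corner_map_inj M N (f : {linear M -> N}) : injective f -> injective (corner_map f).
Proof.
move=> fI x y /(congr1 (@corner_val _ _ c N)); rewrite !corner_map_val.
by move=> /fI /corner_val_inj.
Qed.

Lemma corner_map_surj M N (f : {linear M -> N}) :
  range f = [set: N] -> range (corner_map f) = [set: corner c N].
Proof.
move=> fS; apply/seteqP; split=> // y _.
have : [set: N] (corner_val y) by [].
rewrite -fS => -[x _ fx].
by exists (corner_proj c x) => //; rewrite corner_map_proj fx corner_valK.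
Qed.

Lemma corner_map_ker M N (f : {linear M -> N}) x :
  ker (corner_map f) x <-> ker f (corner_val x).
Proof.
split=> [/(congr1 (@corner_val _ _ c N))|fx]; first by rewrite corner_map_val.
by apply: corner_val_inj; rewrite corner_map_val; exact: fx.
Qed.

Lemma corner_map_exact M N K (f : {linear M -> N}) (g : {linear N -> K}) :
  range f = ker g -> range (corner_map f) = ker (corner_map g).
Proof.
move=> fg; apply/seteqP; split=> [_ [x _ <-]|y /corner_map_ker].
  by apply/corner_map_ker; rewrite corner_map_val -fg; exists (corner_val x).
rewrite -fg => -[x _ fx].
by exists (corner_proj c x) => //; rewrite corner_map_proj fx corner_valK.
Qed.

Lemma corner_isomorphic M N : isomorphic M N -> isomorphic (corner c M) (corner c N).
Proof.
case=> f [g fK gK]; exists (corner_map f).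
exists (fun y => corner_proj c (g (corner_val y))) => x.
  by rewrite [corner_val _]corner_map_val fK corner_valK.
by rewrite [LHS]corner_map_proj gK corner_valK.
Qed.

Lemma corner_finitely_generated M :
  finitely_generated M -> finitely_generated (corner c M).
Proof.
case=> n [v vM]; exists n, (fun i => corner_proj c (v i)) => x.
have [b xE] := vM (corner_val x); exists (fun i => corner_pi c (b i)).
rewrite -[x]corner_valK xE.
have proj0 : corner_proj c (0 : M) = 0.
  by apply: corner_val_inj; rewrite corner_projE scaler0.
elim/big_rec2: _ => // i y z _ <-; exact: corner_proj_linear.
Qed.

(** Restriction of scalars along [pi] is right adjoint to [M |-> e M]: an
    [A]-linear map [f] from [e P] to [N] is the same as the [B]-linear map
    [x |-> f (e x)] from [P] to the restriction of [N]. As restriction preserves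
    surjections, a lifting problem for [e P] becomes one for [P]. *)
Lemma corner_projective P : projective P -> projective (corner c P).
Proof.
move=> prP M N g f gS.
pose pM : lmodType B := pullback (corner_pi c) M.
pose pN : lmodType B := pullback (corner_pi c) N.
have g'_lin : linear (g : pM -> pN) by move=> b x y; exact: linearP.
pose g' : {linear pM -> pN} := linear_fun g'_lin.
have f'_lin : linear ((fun x => f (corner_proj c x)) : P -> pN).
  by move=> b x y; rewrite corner_proj_linear; exact: linearP.
pose f' : {linear P -> pN} := linear_fun f'_lin.
have [h hE] := prP pM pN g' f' gS.
have k_lin : linear ((fun x => h (corner_val x)) : corner c P -> M).
  move=> a x y; rewrite corner_val_linear [LHS]linearP; congr (_ + _).
  by rewrite -[a in RHS](corner_iotaK c).
exists (linear_fun k_lin).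
by move=> x; exact: etrans (hE _) (congr1 f (corner_valK x)).
Qed.

(** A submodule [X] of [e M] is pulled back to [{y | e y in X}], which is a
    [B]-submodule because [e b] depends only on [pi b]. If [X] and the kernel on
    [e M] span [e M], then the pullback and the kernel on [M] span [M]. *)
Lemma corner_superfluous M N (f : {linear M -> N}) :
  superfluous (ker f) -> superfluous (ker (corner_map f)).
Proof.
move=> sf X [X0 XL] XS.
pose Y : set M := [set y | X (corner_proj c y)].
have sY : submodule Y.
  split=> [|b x y Yx Yy]; last by rewrite /Y /= corner_proj_linear; exact: XL.
  rewrite /Y /=; have -> // : corner_proj c (0 : M) = 0.
  by apply: corner_val_inj; rewrite corner_projE scaler0.
have YT : Y = [set: M].
  apply: sf => //; apply/seteqP; split=> // m _.
  have : [set: corner c M] (corner_proj c m) by [].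
  rewrite -XS => -[x Xx [k /corner_map_ker kf xk]].
  exists (m - corner_val k); last by exists (corner_val k); rewrite ?subrK.
  rewrite /Y /= addrC -scaleN1r corner_proj_linear rmorphN1 scaleN1r corner_valK.
  by rewrite -xk addrC addrK.
apply/seteqP; split=> // x _; rewrite -[x]corner_valK.
by have : [set: M] (corner_val x) by []; rewrite -YT.
Qed.

Lemma corner_syzygy M K : is_syzygy M K -> is_syzygy (corner c M) (corner c K).
Proof.
case=> P [p [i [[fgP prP pS sp] iI ip]]].
exists (corner c P), (corner_map p), (corner_map i); split; first split.
- exact: corner_finitely_generated.
- exact: corner_projective.
- exact: corner_map_surj.
- exact: corner_superfluous.
- exact: corner_map_inj.
- exact: corner_map_exact.
Qed.

Lemma corner_nth_syzygy n M K :
  is_nth_syzygy n M K -> is_nth_syzygy n (corner c M) (corner c K).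
Proof.
elim: n K => [|n IHn] K /=; first exact: corner_isomorphic.
by case=> L [ML LK]; exists (corner c L); split; [exact: IHn|exact: corner_syzygy].
Qed.

Lemma corner_stable_retract M N :
  stable_retract M N -> stable_retract (corner c M) (corner c N).
Proof.
case=> P [fgP prP [M' [f [g fK gK]]]]; exists (corner c P); split.
- exact: corner_finitely_generated.
- exact: corner_projective.
exists (corner c M').
pose F (x : corner c M * corner c M') : corner c N * corner c P :=
  let y := f (corner_val x.1, corner_val x.2) in (corner_proj c y.1, corner_proj c y.2).
pose G (y : corner c N * corner c P) : corner c M * corner c M' :=
  let x := g (corner_val y.1, corner_val y.2) in (corner_proj c x.1, corner_proj c x.2).
have F_lin : linear F.
  move=> a x y; rewrite /F /= !corner_val_linear.
  have -> : (corner_iota c a *: corner_val x.1 + corner_val y.1,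
             corner_iota c a *: corner_val x.2 + corner_val y.2) =
    corner_iota c a *: (corner_val x.1, corner_val x.2) +
    (corner_val y.1, corner_val y.2) :> M * M' by [].
  by rewrite linearP /= !corner_proj_linear corner_iotaK.
have fixf x : (f (corner_val x.1, corner_val x.2) : N * P) =
    (corner_val (F x).1, corner_val (F x).2).
  rewrite /F /= !corner_projE -[RHS]/(corner_iota c 1 *: f _) -linearZ /=.
  by congr (f _); congr pair; rewrite /= corner_valE.
exists (linear_fun F_lin).
exists G => [x|y].
  by rewrite -[LHS]/(G (F x)) /G -fixf fK /= !corner_valK -surjective_pairing.
rewrite -[LHS]/(F (G y)) /F /G /= !corner_projE.
have -> : forall u : M * M',
  (corner_iota c 1 *: u.1, corner_iota c 1 *: u.2) = corner_iota c 1 *: u by [].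
by rewrite linearZ /= gK /= !corner_valE !corner_valK -surjective_pairing.
Qed.

End CornerFunctor.

Section DeloopingLevels.
Variables (A B : pzRingType) (c : corner_data A B).

Lemma dell_corner k (M : lmodType B) : (dell k (corner c M) <= dell k M)%E.
Proof.
apply: subset_nat_inf => n [K [N [L [MK fgN NL KL]]]].
exists (corner c K), (corner c N), (corner c L); split.
- exact: corner_nth_syzygy.
- exact: corner_finitely_generated.
- exact: corner_nth_syzygy.
- exact: corner_stable_retract.
Qed.

(** Applying [M |-> e M] to a resolution of the restriction of [S] along [pi]
    gives a resolution of [S] itself, since [e] acts as the identity there. *)
Lemma ddell_pullback (S : lmodType A) :
  (ddell S <= ddell (pullback (corner_pi c) S : lmodType B))%E.
Proof.
apply: subset_nat_inf => m [n nm [C [d [e [[fgC C0 eS de dd] Cm]]]]].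
exists n => //.
have e'_lin : linear ((fun x => e (corner_val x)) : corner c (C 0%N) -> S).
  move=> a x y; rewrite corner_val_linear [LHS]linearP; congr (_ + _).
  by rewrite -[a in RHS](corner_iotaK c).
exists (fun i => corner c (C i)), (fun i => corner_map (d i)), (linear_fun e'_lin).
split; last by move=> i /Cm; apply: le_trans; exact: dell_corner.
have e'E x : linear_fun e'_lin x = e (corner_val x) by [].
split.
- by move=> i; exact: corner_finitely_generated.
- move=> i /C0 Ci0; apply/seteqP; split=> // x _; apply: corner_val_inj.
  by have : [set: C i] (corner_val x) by []; rewrite Ci0 => ->.
- apply/seteqP; split=> // s _.
  have : [set: (pullback (corner_pi c) S : lmodType B)] s by [].
  rewrite -eS => -[x _ xs]; exists (corner_proj c x) => //.
  rewrite [LHS]e'E corner_projE linearZ /= xs.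
  by rewrite -[LHS]/(corner_pi c (corner_iota c 1) *: (s : S)) corner_iotaK scale1r.
- apply/seteqP; split=> [_ [x _ <-]|x ex].
    rewrite -[ker _ _]/(e (corner_val (corner_map (d 0%N) x)) = 0) corner_map_val.
    have : range (d 0%N) (d 0%N (corner_val x)) by exists (corner_val x).
    by rewrite de.
  have : ker e (corner_val x) by [].
  rewrite -de => -[y _ yx]; exists (corner_proj c y) => //.
  by rewrite [LHS]corner_map_proj yx corner_valK.
- by move=> i; exact: corner_map_exact.
Qed.

Lemma simple_pullback (S : lmodType A) :
  simple_module S -> simple_module (pullback (corner_pi c) S : lmodType B).
Proof.
case=> S0 simS; split=> // N [N0 NL]; apply: simS; split=> // a x y Nx Ny.
by have := NL (corner_iota c a) _ _ Nx Ny; rewrite -[in X in _ -> X](corner_iotaK c a).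
Qed.

End DeloopingLevels.

Lemma ddell_alg_corner (A B : pzRingType) : corner_data A^c B^c ->
  (ddell_alg A <= ddell_alg B)%E.
Proof.
move=> c; apply: supremum_le => [_ [S [_ <-]]|_ [S [_ <-]]|_ [S [simS <-]]];
  try exact: nat_inf_nat_or_pinfty.
exists (ddell (pullback (corner_pi c) S : lmodType B^c)); last exact: ddell_pullback.
by exists (pullback (corner_pi c) S : lmodType B^c); split=> //; exact: simple_pullback.
Qed.

(** * Finitely generated modules over artinian rings *)

Section FinitelyGenerated.
Variable R : pzRingType.
Implicit Types M N : lmodType R.

Lemma finitely_generated_regular : finitely_generated (R^o : lmodType R).
Proof.
exists 1%N, (fun=> 1) => x; exists (fun=> x).
by rewrite big_ord1 [RHS]mulr1.
Qed.

Lemma finitely_generated_image M N (f : {linear M -> N}) :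
  range f = [set: N] -> finitely_generated M -> finitely_generated N.
Proof.
move=> fS [n [v vM]]; exists n, (f \o v) => y.
have : [set: N] y by []; rewrite -fS => -[x _ <-]; have [c ->] := vM x.
by exists c; rewrite raddf_sum; apply: eq_bigr => i _; exact: linearZ.
Qed.

Lemma finitely_generated_prod M N :
  finitely_generated M -> finitely_generated N ->
  finitely_generated (M * N : lmodType R)%type.
Proof.
move=> [m [v vM]] [n [w wN]].
exists (m + n)%N, (fun i => match split i with inl j => (v j, 0) | inr j => (0, w j) end).
move=> [x y]; have [c xE] := vM x; have [c' yE] := wN y.
exists (fun i => match split i with inl j => c j | inr j => c' j end).
rewrite big_split_ord /= [X in X + _](_ : _ = (x, 0)) ?[X in _ + X](_ : _ = (0, y)).
- by congr pair; rewrite /= ?addr0 ?add0r.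
- rewrite (eq_bigr (fun i => (0, c' i *: w i))) => [|i _]; last first.
    by rewrite (unsplitK (inr i)); congr pair; rewrite /= scaler0.
  rewrite yE; elim/big_rec2: _ => // i y1 y2 _ ->; congr pair; exact: addr0.
rewrite (eq_bigr (fun i => (c i *: v i, 0))) => [|i _]; last first.
  by rewrite (unsplitK (inl i)); congr pair; rewrite /= scaler0.
rewrite xE; elim/big_rec2: _ => // i y1 y2 _ ->; congr pair; exact: addr0.
Qed.

(** The span of [w 0, ..., w (k - 1)], defined by recursion so that inductions
    on [k] peel off the last generator. *)
Fixpoint partial_span (M : lmodType R) (w : nat -> M) (k : nat) : set M :=
  if k is k'.+1 then [set x | exists a, partial_span w k' (x - a *: w k')]
  else [set 0].

Lemma partial_span_submodule M (w : nat -> M) k : submodule (partial_span w k).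
Proof.
elim: k => [|k [IH0 IHL]] /=; first by split=> // a x y -> ->; rewrite scaler0 addr0.
split=> [|r x y [a xa] [b yb]]; first by exists 0; rewrite scale0r subrr.
exists (r * a + b).
rewrite (_ : _ - _ = r *: (x - a *: w k) + (y - b *: w k)); first exact: IHL.
by rewrite scalerBr scalerDl scalerA opprD addrACA.
Qed.

Lemma partial_span_sum M (w : nat -> M) k (c : nat -> R) :
  partial_span w k (\sum_(i < k) c i *: w i).
Proof.
by elim: k => [|k IHk] /=; [rewrite big_ord0|exists (c k); rewrite big_ord_recr /= addrK].
Qed.

(** For a descending chain [N m], the coefficients of [w k] in the elements of
    [N m] that lie in the span of the generators up to [w k] form a descending
    chain of left ideals for each [k]. Beyond the index where the finitely many
    chains of ideals are stationary, so is [N]: an element of the larger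
    submodule is corrected, one generator after the other, by elements of the
    smaller one. *)
Theorem finitely_generated_artinian M :
  artinian_module (R^o : lmodType R) -> finitely_generated M -> artinian_module M.
Proof.
move=> artR [n [v vM]] N sN N_S.
pose w i := oapp v 0 (insub i : option 'I_n).
have wE (i : 'I_n) : w i = v i by rewrite /w valK.
have wT x : partial_span w n x.
  have [c ->] := vM x; have := partial_span_sum w n (fun i => oapp c 0 (insub i)).
  by under eq_bigr do rewrite wE valK.
have N_le m m' : (m <= m')%N -> N m' `<=` N m.
  elim: m' => [|m' IH]; first by rewrite leqn0 => /eqP ->.
  rewrite leq_eqVlt => /predU1P[-> //|]; rewrite ltnS => /IH.
  by move=> sub x /N_S /sub.
pose I k m : set R^o := [set a | exists2 x, N m x & partial_span w k (x - a *: w k)].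
have sI k m : submodule (I k m).
  have [N0 NL] := sN m; have [P0 PL] := partial_span_submodule w k.
  split=> [|r a b [x Nx xa] [y Ny yb]]; first by exists 0 => //; rewrite scale0r subrr.
  exists (r *: x + y); first exact: NL.
  rewrite (_ : _ - _ = r *: (x - (a : R) *: w k) + (y - (b : R) *: w k)); first exact: PL.
  by rewrite scalerBr scalerA [X in _ - X]scalerDl opprD addrACA.
have I_S k m : I k m.+1 `<=` I k m by move=> a [x /N_S Nx xa]; exists x.
have /choice [K KP] k := artR (I k) (sI k) (I_S k).
pose L := (\max_(k < n) K k)%N.
exists L => m Lm; apply/seteqP; split; first exact: N_le.
have Im k : (k < n)%N -> I k L = I k m.
  move=> kn; have KL : (K k <= L)%N by exact: (leq_bigmax (Ordinal kn)).
  by rewrite (KP k L KL) (KP k m (leq_trans KL Lm)).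
suff main k : (k <= n)%N -> forall x, N L x -> partial_span w k x -> N m x.
  by move=> x Nx; exact: main (leqnn n) _ Nx (wT x).
elim: k => [_ x _ ->|k IHk kn x Nx [a xa]]; first by have [] := sN m.
have : I k L a by exists x.
rewrite Im // => -[y Ny ya].
have NLy := N_le _ _ Lm _ Ny.
have Nxy : N m (x - y).
  apply: IHk (ltnW kn) _ _ _.
    by rewrite addrC -scaleN1r; apply: (sN L).2.
  rewrite (_ : x - y = -1 *: (y - a *: w k) + (x - a *: w k)).
    exact: (partial_span_submodule w k).2.
  by rewrite scaleN1r opprB [RHS]addrC addrA subrK.
by rewrite -(subrK y x) -[x - y]scale1r; apply: (sN m).2.
Qed.

End FinitelyGenerated.

(** * Simple modules embed into the semisimple quotient *)

Section SimpleEmbedding.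
Variable D : pzRingType.

Lemma artinian_minimal (M : lmodType D) (P : set (set M)) :
  artinian_module M -> P `<=` @submodule D M -> P !=set0 ->
  exists2 N, P N & forall N', P N' -> N' `<=` N -> N' = N.
Proof.
move=> artM subP [N0 PN0]; apply: contrapT => nomin.
have smaller (N : {N | P N}) : exists N' : {N | P N},
    sval N' `<=` sval N /\ sval N' <> sval N.
  case: N => N PN /=; apply: contrapT => nN; apply: nomin; exists N => // N' PN' N'N.
  by apply: contrapT => N'neq; apply: nN; exists (exist _ N' PN').
have [next nextP] := choice smaller.
pose s n := sval (iter n next (exist _ N0 PN0)).
have [n|n|n sn] := artM s.
- by apply: subP; exact: svalP.
- exact: (nextP _).1.
by have := (nextP (iter n next (exist _ N0 PN0))).2; apply; exact: (sn n.+1 (leqnSn n)).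
Qed.

(** This is the Jacobson radical of [D]. *)
Definition simple_annihilator : set D^o :=
  [set x | forall S : lmodType D, simple_module S -> forall s : S, (x : D) *: s = 0].

Lemma simple_annihilator_submodule :
  submodule (simple_annihilator : set (D^o : lmodType D)).
Proof.
split=> [S _ s|a x y Jx Jy S simS s]; first by rewrite scale0r.
by rewrite scalerDl -[a *: x]/(a * x : D) -scalerA Jx // Jy // scaler0 addr0.
Qed.

Lemma simple_submodule (S : lmodType D) (N : set S) x :
  simple_module S -> submodule N -> N x -> x <> 0 -> N = [set: S].
Proof. by move=> [_ simS] /simS [->|//] ->. Qed.

Lemma simple_cyclic (S : lmodType D) (t s : S) :
  simple_module S -> t <> 0 -> exists a : D, s = a *: t.
Proof.
move=> simS t0; have : [set: S] s by [].
rewrite -(@simple_submodule S [set s | exists a : D, s = a *: t] t) //.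
- split=> [|a _ _ [b ->] [b' ->]]; first by exists 0; rewrite scale0r.
  by exists (a * b + b'); rewrite scalerDl scalerA.
- by exists 1; rewrite scale1r.
Qed.

(** Fix [t <> 0] in [T] and a left ideal [N] that is minimal among those that
    contain [J] and do not kill [t]. Then [x |-> x t] maps [N] onto [T], and its
    kernel is [J] (this is [keyJ]), so that [T] is isomorphic to [N / J]. *)
Theorem simple_embeds (T : lmodType D) :
  artinian_module (D^o : lmodType D) -> simple_module T ->
  exists f : {linear T -> quotmod simple_annihilator_submodule}, injective f.
Proof.
move=> artD simT; have [[t /eqP t0] _] := simT.
set sJ := simple_annihilator_submodule; pose J := simple_annihilator.
pose P : set (set (D^o : lmodType D)) :=
  [set N | [/\ submodule N, J `<=` N & exists2 y, N y & (y : D) *: t <> 0]].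
have [N [sN JN [y0 Ny0 y0t]] minN] :
    exists2 N, P N & forall N', P N' -> N' `<=` N -> N' = N.
  apply: artinian_minimal => // [N []//|]; exists [set: D^o]; split=> //.
  by exists 1; rewrite ?scale1r.
have [N0 NL] := sN.
(* If [x] kills [t] but not [t'] in a simple [T'], then the annihilator of
   [t'] in [N] is proper, so it kills [t] by minimality. But each element of
   [N] agrees on [t'] with a multiple of [x], so all of [N] would kill [t]. *)
have keyJ x : N x -> (x : D) *: t = 0 -> J x.
  move=> Nx xt T' simT' t'; apply: contrapT => xt'.
  pose N' : set D^o := [set y | N y /\ (y : D) *: t' = 0].
  have sN' : submodule (N' : set (D^o : lmodType D)).
    split=> [|a y z [Ny yt'] [Nz zt']]; first by split; rewrite ?scale0r.
    split; first exact: NL.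
    by rewrite scalerDl -[a *: y]/(a * y : D) -scalerA yt' zt' scaler0 addr0.
  have N't y : N' y -> (y : D) *: t = 0.
    move=> N'y; apply: contrapT => yt; have NN' : N' = N.
      apply: minN => [|z []//]; split=> //; last by exists y.
      by move=> z Jz; split; [exact: JN|exact: Jz].
    by move: Nx; rewrite -NN' => -[].
  apply: y0t; have [d y0E] := simple_cyclic ((y0 : D) *: t') simT' xt'.
  have : N' (- d *: x + y0).
    split; first exact: NL.
    by rewrite scalerDl -[- d *: x]/(- d * x : D) -scalerA y0E scaleNr addNr.
  move=> /N't; rewrite scalerDl -[- d *: x]/(- d * x : D) -scalerA xt scaler0 add0r; exact.
have lift (s : T) : exists2 y, N y & (y : D) *: t = s.
  have [d ->] := simple_cyclic s simT y0t; exists (d * y0); last by rewrite scalerA.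
  by rewrite -[d * y0]addr0; exact: NL.
have [g gN gt] : exists2 g : T -> D^o, forall s, N (g s) & forall s, (g s : D) *: t = s.
  have /choice [g gP] s : exists y : D^o, N y /\ (y : D) *: t = s.
    by have [y] := lift s; exists y.
  by exists g => s; have [] := gP s.
have f_lin : linear ((fun s => quot_pi sJ (g s)) : T -> quotmod sJ).
  move=> a s s'; rewrite -[RHS]linearP; apply/quot_pi_eq; apply: keyJ.
    rewrite addrC -scaleN1r; apply: (NL) => //; exact: NL.
  rewrite scalerDl scaleNr scalerDl.
  by rewrite -[a *: g s]/(a * g s : D) -scalerA !gt subrr.
exists (linear_fun f_lin) => s s' /quot_pi_eq Jss'.
apply/eqP; rewrite -subr_eq0; apply/eqP.
have := Jss' _ simT t.
by rewrite scalerDl scaleNr !gt.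
Qed.

End SimpleEmbedding.

(** * Rings with an ideal of square zero containing the simple modules *)

Section EmbeddedSimple.
Variable B : pzRingType.

Lemma projective_regular : projective (B^o : lmodType B).
Proof.
move=> M N g f gS; have : [set: N] (f 1) by [].
rewrite -gS => -[m _ gm].
have h_lin : linear ((fun b => (b : B) *: m) : B^o -> M).
  by move=> a x y; rewrite scalerDl -[a *: x]/(a * x : B) scalerA.
exists (linear_fun h_lin) => x.
rewrite -[LHS]/(g ((x : B) *: m)) linearZ gm -[x in RHS]mulr1.
exact: esym (linearZ _ _).
Qed.

Lemma stable_retract_refl (M : lmodType B) : stable_retract M M.
Proof.
exists (B^o : lmodType B); split.
- exact: finitely_generated_regular.
- exact: projective_regular.
by exists (B^o : lmodType B); exists idfun; exists idfun.
Qed.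

Lemma range_submodule (M N : lmodType B) (f : {linear M -> N}) : submodule (range f).
Proof.
split=> [|a _ _ [x _ <-] [y _ <-]]; first by exists 0; rewrite ?linear0.
by exists (a *: x + y); rewrite ?linearP.
Qed.

(** The projection from [B] to [B / T] is a projective cover because [T] is
    superfluous, so [T] is its syzygy. *)
Lemma dell1_le0 (T : lmodType B) (i : {linear T -> (B^o : lmodType B)}) :
  injective i -> superfluous (range i) -> (dell 1 T <= 0)%E.
Proof.
move=> iI iS; apply: (@nat_inf_le _ 0); pose sN := range_submodule i.
exists T, (quotmod sN : lmodType B), T.
have piS : range (quot_pi sN) = [set: quotmod sN].
  by apply/seteqP; split=> // y _; have [x <-] := quot_pi_surj y; exists x.
have piK : range i = ker (quot_pi sN : {linear (B^o : lmodType B) -> quotmod sN}).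
  apply/seteqP; split=> x.
    by move=> ix; rewrite /ker /= -(linear0 (quot_pi sN)); apply/quot_pi_eq; rewrite subr0.
  by rewrite /ker /= -[in X in X -> _](linear0 (quot_pi sN)) => /quot_pi_eq; rewrite subr0.
have iso : isomorphic T T by exists idfun; exists idfun.
split=> //; last exact: stable_retract_refl.
  exact: finitely_generated_image piS (finitely_generated_regular B).
exists (quotmod sN : lmodType B); split; first by exists idfun; exists idfun.
exists (B^o : lmodType B), (quot_pi sN : {linear _ -> _}), i; split=> //; split=> //.
- exact: finitely_generated_regular.
- exact: projective_regular.
- by rewrite -piK.
Qed.

(** The module is its own resolution of length 0. *)
Lemma ddell_eq0 (T : lmodType B) :
  finitely_generated T -> (dell 1 T <= 0)%E -> ddell T = 0%E.
Proof.
move=> fgT dT; apply/eqP; rewrite eq_le nat_inf_ge0 andbT.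
apply: (@nat_inf_le _ 0); exists 0%N => //.
pose Z : lmodType B := 'rV[B]_0.
have Z0 : [set: Z] = [set 0] by apply/seteqP; split=> // x _; exact: thinmx0.
exists (fun i => if i is _.+1 then Z else T), (fun=> \0), idfun.
split; last by case.
split.
- case=> // _; exists 0%N, (fun=> 0) => x; exists (fun=> 0).
  by rewrite big_ord0; exact: thinmx0.
- by case.
- by apply/seteqP; split=> // x _; exists x.
- apply/seteqP; split=> [_ [x _ <-]//|x x0]; by exists 0.
- by move=> i; apply/seteqP; split=> // x _; exists 0 => //; rewrite [RHS]thinmx0.
Qed.

Lemma simple_finitely_generated (T : lmodType B) :
  simple_module T -> finitely_generated T.
Proof.
move=> simT; have [[t /eqP t0] _] := simT; exists 1%N, (fun=> t) => x.
by have [a ->] := simple_cyclic x simT t0; exists (fun=> a); rewrite big_ord1.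
Qed.

End EmbeddedSimple.

(** [B] is given as the sum of the image of [D] under a ring morphism [s] and of
    an ideal [j V] of square zero with quotient [D]. Only the left module
    structure of this ideal is prescribed. *)
Section SquareZeroIdeal.
Variables (B D : pzRingType) (V : lmodType D).
Variables (s : {rmorphism D -> B}) (r : {rmorphism B -> D}) (j : {additive V -> B}).
Hypothesis sj_dec : forall b, exists v, b = s (r b) + j v.
Hypothesis jM : forall b v, b * j v = j (r b *: v).
Hypothesis jI : injective j.
Hypothesis rj : forall v, r (j v) = 0.

Lemma j_square_zero v v' : j v * j v' = 0.
Proof. by rewrite jM rj scale0r raddf0. Qed.

(** The elements killed by the ideal [range j] form a submodule. As the
    ideal has square zero, it contains all products [j v *: t]; so it is zero
    only if all of them vanish, that is, if it is everything. *)
Lemma simple_killed (T : lmodType B) v (t : T) : simple_module T -> j v *: t = 0.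
Proof.
move=> simT; pose N : set T := [set t | forall v, j v *: t = 0].
have sN : submodule N.
  split=> [w|b x y Nx Ny w]; first by rewrite scaler0.
  rewrite scalerDr Ny addr0 scalerA; have [u ->] := sj_dec (j w * b).
  by rewrite rmorphM /= rj mul0r rmorph0 add0r Nx.
have [_ /(_ N sN)[N0|NT]] := simT; last first.
  by have : [set: T] t by []; rewrite -NT; apply.
have : N (j v *: t) by move=> w; rewrite scalerA j_square_zero scale0r.
by rewrite N0.
Qed.

(** If a left ideal and [K] span [B], then the left ideal contains some [1 - y]
    with [y] of square zero, which is a unit with inverse [1 + y]. *)
Lemma square_zero_superfluous (K : set (B^o : lmodType B)) :
  K `<=` range (j : V -> B^o) -> superfluous K.
Proof.
move=> Kj N [N0 NL] NK; apply/seteqP; split=> // b _.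
have : [set: B^o] 1 by []; rewrite -NK => -[n Nn [k /Kj[v _ vk] nk]].
have N1 : N 1.
  have := NL (1 + j v) _ _ Nn N0; rewrite addr0.
  have -> : n = 1 - j v by rewrite vk -nk addrK.
  rewrite -[(_ + _) *: _]/((1 + j v) * (1 - j v) : B).
  by rewrite mulrBr mulr1 mulrDl mul1r j_square_zero addr0 addrK.
by have := NL b _ _ N1 N0; rewrite addr0 [X in N X]mulr1.
Qed.

(** A simple [B]-module is killed by the ideal, hence is a simple [D]-module and
    embeds into [V]; followed by [j], this is an embedding into [B]. *)
Lemma ddell_simple_eq0 :
  (forall S : lmodType D, simple_module S -> exists f : {linear S -> V}, injective f) ->
  forall T : lmodType B, simple_module T -> ddell T = 0%E.
Proof.
move=> embV T simT; apply: ddell_eq0; first exact: simple_finitely_generated.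
have actE b (t : T) : b *: t = s (r b) *: t.
  have [v bE] := sj_dec b; rewrite {1}bE scalerDl.
  by rewrite (simple_killed v t simT) addr0.
have simT' : simple_module (pullback s T : lmodType D).
  have [T0 simT'] := simT; split=> // N [N0 NL]; apply: simT'; split=> // b x y Nx Ny.
  by rewrite actE; exact: (NL (r b) x y).
have [f fI] := embV _ simT'.
have i_lin : linear ((fun t => j (f t)) : T -> B^o).
  move=> b x y; rewrite -[RHS]/(b * j (f x) + j (f y)) jM -raddfD actE.
  by congr (j _); exact: (linearP f (r b) x y).
apply: (@dell1_le0 _ _ (linear_fun i_lin)); first by move=> x y /jI /fI.
by apply: square_zero_superfluous => _ [t _ <-]; exists (f t).
Qed.

End SquareZeroIdeal.

(** * The extension of an Artin algebra *)

Lemma artin_algebra_converse (A : pzRingType) : artin_algebra A -> artin_algebra A^c.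
Proof.
move=> [R [f [artR fC [n [v vA]]]]].
have f_zmod : zmod_morphism (f : R -> A^c) by move=> x y; exact: (rmorphB f x y).
have f_mon : monoid_morphism (f : R -> A^c).
  by split; [exact: (rmorph1 f)|move=> x y; rewrite mulrC; exact: (rmorphM f)].
pose g : {rmorphism R -> A^c} := HB.pack_for {rmorphism R -> A^c} (f : R -> A^c)
  (GRing.isZmodMorphism.Build _ _ _ f_zmod) (GRing.isMonoidMorphism.Build _ _ _ f_mon).
exists R, g; split=> //; first by move=> r a; exact: esym (fC r a).
exists n, v => a; have [c aE] := vA a; exists c; rewrite [LHS]aE.
apply: eq_bigr => i _; exact: fC.
Qed.

Section KaschExtension.
Variables (A : pzRingType) (R : comPzRingType) (f : {rmorphism R -> A}).
Hypothesis fC : forall r a, f r * a = a * f r.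

Local Notation D := (A * R)%type.

Definition scalars (r : R) : D := (f r, r).
Lemma scalars_zmod : zmod_morphism scalars.
Proof. by move=> x y; rewrite /scalars rmorphB. Qed.
Lemma scalars_monoid : monoid_morphism scalars.
Proof. by split=> [|x y]; rewrite /scalars ?rmorph1 ?rmorphM. Qed.
HB.instance Definition _ := GRing.isZmodMorphism.Build R D scalars scalars_zmod.
HB.instance Definition _ := GRing.isMonoidMorphism.Build R D scalars scalars_monoid.

Lemma scalars_central r (d : D) : scalars r * d = d * scalars r.
Proof. by case: d => a x; congr pair; [exact: fC|exact: mulrC]. Qed.

Definition semisimple_top : lmodType D := quotmod (simple_annihilator_submodule D).
(** The name recalls that every simple left module embeds into this ring, that
    is, it is left Kasch. *)
Definition kasch_ext : pzRingType :=
  trivext semisimple_top (snd : {rmorphism D -> R}) scalars_central.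

Lemma kasch_mulE (x y : kasch_ext) :
  x * y = (x.1 * y.1, x.1 *: y.2 + scalars y.1.2 *: x.2).
Proof. by []. Qed.

Definition kasch_scalars (r : R) : kasch_ext := (scalars r, 0).
Lemma kasch_scalars_zmod : zmod_morphism kasch_scalars.
Proof. by move=> x y; rewrite /kasch_scalars rmorphB; congr pair; rewrite subr0. Qed.
Lemma kasch_scalars_monoid : monoid_morphism kasch_scalars.
Proof.
split=> [|x y]; rewrite /kasch_scalars ?rmorph1 ?rmorphM //.
by rewrite kasch_mulE !scaler0 addr0.
Qed.
HB.instance Definition _ :=
  GRing.isZmodMorphism.Build R kasch_ext kasch_scalars kasch_scalars_zmod.
HB.instance Definition _ :=
  GRing.isMonoidMorphism.Build R kasch_ext kasch_scalars kasch_scalars_monoid.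

Hypothesis artR : artinian_ring R.
Hypothesis fgA : finitely_generated (pullback f A^o : lmodType R).

Lemma finitely_generated_factors : finitely_generated (pullback scalars D^o : lmodType R).
Proof.
have id_lin : linear (id : (pullback f A^o * R^o)%type -> pullback scalars D^o) by [].
apply: (@finitely_generated_image _ _ _ (linear_fun id_lin)).
  by apply/seteqP; split=> // x _; exists x.
exact/finitely_generated_prod/finitely_generated_regular.
Qed.

Lemma finitely_generated_top :
  finitely_generated (pullback scalars semisimple_top : lmodType R).
Proof.
pose p := quot_pi (simple_annihilator_submodule D).
have p_lin : linear (p : pullback scalars D^o -> pullback scalars semisimple_top).
  by move=> r x y; exact: (linearP p (scalars r) x y).
apply: (@finitely_generated_image _ _ _ (linear_fun p_lin) _ finitely_generated_factors).
apply/seteqP; split=> // y _; have [x xy] := quot_pi_surj (y : semisimple_top).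
by exists x.
Qed.

Lemma finitely_generated_kasch :
  finitely_generated (pullback kasch_scalars kasch_ext^o : lmodType R).
Proof.
have id_lin : linear (id : (pullback scalars D^o * pullback scalars semisimple_top)%type ->
    pullback kasch_scalars kasch_ext^o).
  move=> r x y; congr (_ + _); rewrite -[RHS]/(kasch_scalars r * (x : kasch_ext)).
  by rewrite kasch_mulE /= scaler0 addr0.
apply: (@finitely_generated_image _ _ _ (linear_fun id_lin)).
  by apply/seteqP; split=> // x _; exists x.
exact: finitely_generated_prod finitely_generated_factors finitely_generated_top.
Qed.

Lemma artin_kasch : artin_algebra kasch_ext.
Proof.
exists R, kasch_scalars; split=> //; last exact: finitely_generated_kasch.
move=> r [d v]; rewrite !kasch_mulE /= !scaler0 addr0 add0r; congr pair.
exact: scalars_central.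
Qed.

Lemma artinian_factors : artinian_module (D^o : lmodType D).
Proof.
move=> N sN N_S; apply: (finitely_generated_artinian artR finitely_generated_factors) => // n.
have [N0 NL] := sN n; split=> // r x y; exact: NL.
Qed.

Lemma ddell_alg_kasch : ddell_alg kasch_ext^c = 0%E.
Proof.
pose B := kasch_ext^c^c; pose V := semisimple_top.
have s_zmod : zmod_morphism ((fun d => (d, 0)) : D -> B).
  by move=> x y; congr pair; rewrite subr0.
have s_monoid : monoid_morphism ((fun d => (d, 0)) : D -> B).
  split=> // x y; rewrite -[RHS]/(((x, 0) : kasch_ext) * (y, 0)) kasch_mulE.
  by rewrite !scaler0 addr0.
pose s : {rmorphism D -> B} := HB.pack_for {rmorphism D -> B} ((fun d => (d, 0)) : D -> B)
  (GRing.isZmodMorphism.Build _ _ _ s_zmod) (GRing.isMonoidMorphism.Build _ _ _ s_monoid).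
have r_zmod : zmod_morphism (fst : B -> D) by [].
have r_monoid : monoid_morphism (fst : B -> D) by [].
pose r : {rmorphism B -> D} := HB.pack_for {rmorphism B -> D} (fst : B -> D)
  (GRing.isZmodMorphism.Build _ _ _ r_zmod) (GRing.isMonoidMorphism.Build _ _ _ r_monoid).
have j_zmod : zmod_morphism ((fun v => (0, v)) : V -> B).
  by move=> x y; congr pair; rewrite subr0.
pose j : {additive V -> B} := HB.pack_for {additive V -> B} ((fun v => (0, v)) : V -> B)
  (GRing.isZmodMorphism.Build _ _ _ j_zmod).
have ddell0 : forall T : lmodType B, simple_module T -> ddell T = 0%E.
  apply: (@ddell_simple_eq0 B D V s r j) => //.
  - by move=> [d v]; exists v; congr pair; rewrite /= ?addr0 ?add0r.
  - move=> b v; rewrite -[LHS]/((b : kasch_ext) * (0, v)) kasch_mulE mulr0.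
    by congr pair; rewrite [scalars _](rmorph0 scalars) scale0r addr0.
  - by move=> x y [].
  - by move=> S; apply: simple_embeds; exact: artinian_factors.
have [E|/set0P [x Ex]] :=
    eqVneq [set x | exists S : lmodType B, simple_module S /\ ddell S = x] set0.
  by rewrite /ddell_alg E supremum0.
rewrite /ddell_alg (_ : [set _ | _] = [set 0%E]) ?supremum1 //.
apply/seteqP; split=> [_ [T [simT <-]]|_ ->]; first exact: ddell0.
by case: Ex => T [simT _]; exists T; split=> //; exact: ddell0.
Qed.

(** The idempotent is [((1, 0), 0)]. It kills the ideal when it acts from the
    right, as its component in [R] is 0. *)
Lemma kasch_corner : corner_data A^c kasch_ext^c^c^c.
Proof.
have p_zmod : zmod_morphism ((fun h => h.1.1) : kasch_ext^c^c^c -> A^c) by [].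
have p_monoid : monoid_morphism ((fun h => h.1.1) : kasch_ext^c^c^c -> A^c) by [].
pose p := HB.pack_for {rmorphism kasch_ext^c^c^c -> A^c} ((fun h => h.1.1) : kasch_ext^c^c^c -> A^c)
  (GRing.isZmodMorphism.Build _ _ _ p_zmod) (GRing.isMonoidMorphism.Build _ _ _ p_monoid).
apply: (@CornerData _ _ p (fun a => ((a, 0), 0))) => // -[[a x] v].
rewrite -[LHS]/((((a, x), v) : kasch_ext) * ((1, 0), 0)) kasch_mulE.
rewrite scaler0 add0r [scalars _](rmorph0 scalars) scale0r.
by congr pair; congr pair; rewrite ?mulr1 ?mulr0.
Qed.

End KaschExtension.

Theorem theorem1p1 :
  (forall A : pzRingType, artin_algebra A -> (ddell_alg A < +oo)%E) <->
  (forall A : pzRingType, artin_algebra A ->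
     ddell_alg A = 0%E -> (ddell_alg A^c < +oo)%E).
Proof.
split=> [fin A artA _|fin A [R [f [artR fC fgA]]]].
  exact/fin/artin_algebra_converse.
apply: (le_lt_trans (ddell_alg_corner (kasch_corner fC))).
apply: fin; first exact/artin_algebra_converse/artin_kasch.
exact: ddell_alg_kasch.
Qed.
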